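(* Let $G=(V,E)$ be a simple graph with $n=|V|\geqslant 1$ vertices and $m=|E|\geqslant 1$ edges, and let $\mathcal{M}(G)$ and $t$ be as defined in the context. Then $G$ has a three-coloring if and only if $\delta_n(\mathcal{M}(G))\leqslant\sqrt{mt^2+4nt^6+mt^{10}}$.
   Context: For a real matrix $X$, $\|X\|$ denotes the Frobenius norm. For $M\in\mathbb{R}^{r\times c}$ and $k\leqslant c$, $\delta_k(M)=\min_{S,A}\|M-SA\|$, where $A$ ranges over $\mathbb{R}^{k\times c}$ and $S$ over all $r\times k$ submatrices of $M$ consisting of $k$ of its columns. A three-coloring of $G$ is a map $\varphi:V\to\{1,2,3\}$ with $\varphi(u)\neq\varphi(v)$ whenever $\{u,v\}\in E$. Set $t=\frac{1}{4(m+n)^3}$. For $i\in\{1,2,3\}$ let $V^i=\{v^i: v\in V\}$ be a disjoint copy of $V$. The matrix $\mathcal{M}=\mathcal{M}(G)$ has rows indexed by $V\cup\{1,2,3\}\cup\{\varepsilon\}$ and columns indexed by $V^1\cup V^2\cup V^3\cup E$, with entries, for all distinct $u,v\in V$, distinct $i,j\in\{1,2,3\}$, and $e\in E$: $\mathcal{M}(u,u^i)=1$, $\mathcal{M}(u,v^i)=0$; $\mathcal{M}(u,e)=t^2$ if $u\in e$ and $0$ otherwise; $\mathcal{M}(i,v^i)=t^3$, $\mathcal{M}(i,v^j)=0$, $\mathcal{M}(i,e)=t^5$; $\mathcal{M}(\varepsilon,v^i)=0$, $\mathcal{M}(\varepsilon,e)=t$. *)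

(* Defs.v *)
From HB Require Import structures.
From mathcomp Require Import all_boot all_order all_algebra.
From mathcomp Require Import boolp classical_sets reals.
From mathcomp Require Import zify.

Set Implicit Arguments.
Unset Strict Implicit.
Unset Printing Implicit Defensive.

Import Order.TTheory GRing.Theory Num.Theory.
Local Open Scope ring_scope.

Definition frobenius (R : realType) (r c : nat) (X : 'M[R]_(r, c)) : R :=
  Num.sqrt (\sum_i \sum_j X i j ^+ 2).

(* An r x k submatrix of M made of k of its columns is [colsub f M] with f
   injective; the order in which the columns are listed does not affect the
   set of errors, as A can be permuted accordingly. *)
Definition css_errors (R : realType) (r c k : nat) (M : 'M[R]_(r, c)) : set R :=
  [set x | exists (f : 'I_k -> 'I_c) (A : 'M[R]_(k, c)),
     injective f /\ x = frobenius (M - colsub f M *m A)]%classic.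

(* The infimum is a minimum when k <= c: see [css_delta_min] below. *)
Definition css_delta (R : realType) (r c k : nat) (M : 'M[R]_(r, c)) : R :=
  inf (css_errors k M).

Section Attained.
Variable R : realType.

Let sqn (r c : nat) (X : 'M[R]_(r, c)) : R := \sum_i \sum_j X i j ^+ 2.

Let sqnE r c (X : 'M[R]_(r, c)) : sqn X = \tr (X^T *m X).
Proof.
rewrite /sqn exchange_big /=; apply: eq_bigr => j _; rewrite mxE.
by apply: eq_bigr => i _; rewrite !mxE expr2.
Qed.

Let sqn_ge0 r c (X : 'M[R]_(r, c)) : 0 <= sqn X.
Proof. by do 2!apply: sumr_ge0 => ? _; apply: sqr_ge0. Qed.

Let sqn_eq0 r c (X : 'M[R]_(r, c)) : sqn X = 0 -> X = 0.
Proof.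
move=> X0; apply/matrixP => i j; rewrite mxE; apply/eqP.
rewrite -sqrf_eq0; apply/eqP.
have H : \sum_j X i j ^+ 2 = 0.
  apply: (psumr_eq0P _ X0) => // k _.
  by apply: sumr_ge0 => ? _; apply: sqr_ge0.
by apply: (psumr_eq0P _ H) => // k _; apply: sqr_ge0.
Qed.

Let normal_equations r c k (S : 'M[R]_(r, k)) (M : 'M[R]_(r, c)) :
  exists A : 'M[R]_(k, c), S^T *m (M - S *m A) = 0.
Proof.
have sub : (S <= S^T *m S)%MS.
  have sSS : (S^T *m S <= S)%MS by apply: submxMl.
  rewrite -(geq_leqif (mxrank_leqif_sup sSS)).
  have : (kermx (S^T *m S) <= kermx S^T)%MS.
    apply/sub_kermxP/trmx_inj; rewrite trmx0; apply: sqn_eq0.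
    rewrite sqnE trmxK trmx_mul trmxK mulmxA -(mulmxA (kermx _)).
    by rewrite mulmx_ker mul0mx mxtrace0.
  move/mxrankS; rewrite !mxrank_ker mxrank_tr => h.
  have := rank_leq_col S.
  by have := rank_leq_row (S^T *m S); lia.
have /submxP [D hD] : (M^T *m S <= S^T *m S)%MS.
  exact: submx_trans (submxMl _ _) sub.
exists D^T; rewrite mulmxBr; apply/eqP; rewrite subr_eq0; apply/eqP.
by apply: trmx_inj; rewrite !trmx_mul !trmxK hD mulmxA.
Qed.

Let least_squares r c k (S : 'M[R]_(r, k)) (M : 'M[R]_(r, c)) :
  exists A : 'M[R]_(k, c), forall B : 'M[R]_(k, c),
    frobenius (M - S *m A) <= frobenius (M - S *m B).
Proof.
have [A hA] := normal_equations S M; exists A => B.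
rewrite /frobenius ler_wsqrtr // -/(sqn _) -/(sqn (M - S *m B)).
set Y := M - S *m A in hA *.
have -> : M - S *m B = Y + S *m (A - B).
  by rewrite /Y mulmxBr addrA subrK.
set Z := S *m (A - B).
have c0 : Z^T *m Y = 0 by rewrite trmx_mul -mulmxA hA mulmx0.
have c1 : Y^T *m Z = 0 by apply: trmx_inj; rewrite trmx_mul trmxK c0 trmx0.
have YZ : (Y + Z)^T *m (Y + Z) = Y^T *m Y + Z^T *m Z.
  have -> : (Y + Z)^T = Y^T + Z^T by rewrite raddfD.
  by rewrite mulmxDl !(mulmxDr _ Y Z) c0 c1 addr0 add0r.
by rewrite (sqnE (Y + Z)) YZ mxtraceD -!sqnE lerDl.
Qed.

Lemma css_delta_min (r c k : nat) (M : 'M[R]_(r, c)) : (k <= c)%N ->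
  css_errors k M (css_delta k M) /\
  (forall x, css_errors k M x -> css_delta k M <= x).
Proof.
move=> kc.
have lb0 : has_lbound (css_errors k M).
  by exists 0 => _ [f [A [_ ->]]]; apply: sqrtr_ge0.
split; last by move=> x; apply: ge_inf.
pose best (f : 'I_k -> 'I_c) := projT1 (cid (least_squares (colsub f M) M)).
pose err (f : {ffun 'I_k -> 'I_c}) := frobenius (M - colsub f M *m best f).
pose f0 : {ffun 'I_k -> 'I_c} := [ffun i => widen_ord kc i].
have inj0 : injectiveb f0.
  by apply/injectiveP => i j; rewrite !ffunE => /(congr1 val) /= /val_inj.
have [f /injectiveP injf minf] :=
  @arg_minP _ _ _ f0 (fun f => injectiveb f) err inj0.
suff -> : css_delta k M = err f by exists f, (best f).
have Ef : css_errors k M (err f) by exists f, (best f).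
apply/eqP; rewrite eq_le ge_inf //=; apply: lb_le_inf; first by exists (err f).
move=> _ [g [A [injg ->]]].
have injg' : injectiveb (finfun g).
  by apply/injectiveP => i j; rewrite !ffunE => /injg.
apply: le_trans (minf _ injg') _.
have -> : colsub g M = colsub (finfun g) M.
  by apply/matrixP => i j; rewrite !mxE ffunE.
exact: (projT2 (cid (least_squares (colsub (finfun g) M) M))).
Qed.

End Attained.

(* A simple graph on V is given by its edge set E, a set of pairs of distinct
   vertices; the colors {1,2,3} are the elements of 'I_3. *)
Definition simple_graph (V : finType) (E : {set {set V}}) : Prop :=
  forall e, e \in E -> #|e| = 2.

Definition three_coloring (V : finType) (E : {set {set V}})
    (phi : V -> 'I_3) : Prop :=
  forall u v, [set u; v] \in E -> phi u <> phi v.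

(* inl (inl u) is the row u, inl (inr i) the row i, inr tt the row epsilon;
   inl (v, i) is the column v^i, inr e the column of the edge e. *)
Definition row_index (V : finType) : finType := (V + 'I_3 + unit)%type.

Definition col_index (V : finType) (E : {set {set V}}) : finType :=
  (V * 'I_3 + {e : {set V} | e \in E})%type.

Definition graph_t (R : realType) (V : finType) (E : {set {set V}}) : R :=
  (4 * (#|E| + #|V|)%:R ^+ 3)^-1.

Definition graph_entry (R : realType) (V : finType) (E : {set {set V}})
    (x : row_index V) (y : col_index E) : R :=
  let t := graph_t R E in
  match x, y with
  | inl (inl u), inl (v, i) => if u == v then 1 else 0
  | inl (inl u), inr e => if u \in val e then t ^+ 2 else 0
  | inl (inr i), inl (v, j) => if i == j then t ^+ 3 else 0
  | inl (inr i), inr e => t ^+ 5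
  | inr _, inl _ => 0
  | inr _, inr e => t
  end.

Definition graph_mx (R : realType) (V : finType) (E : {set {set V}}) :
    'M[R]_(#|row_index V|, #|col_index E|) :=
  \matrix_(a, b) graph_entry R (enum_val a) (enum_val b).

(* Main.v *)
Require Import Defs.
From mathcomp Require Import all_boot all_order all_algebra.
From mathcomp Require Import boolp reals.
From mathcomp Require Import ring lra.

Import Order.TTheory GRing.Theory Num.Theory.

Local Open Scope ring_scope.

(** If the selected submatrix [S] approximates [M(G)] within the threshold, its
    restriction [S'] to the rows in [V] is an [n x n] matrix with [S' P] close to
    the identity, [P] being the coefficients of the columns [v^1].  So some [y]
    satisfies [y S' = (row epsilon of S)], and as [y S' P] must be small, [y] is
    small.  A selected edge column [{u, w}] would force [t^2 (y_u + y_w) = t], so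
    only vertex columns are selected, and invertibility gives one column
    [v^(phi v)] per vertex.  The least-squares error of such a selection is,
    up to lower order terms, that of the choice [A v y = M v y], namely
    [m t^2 + 4 n t^6 + m t^10] plus [2 t^10] per monochromatic edge. *)

(** * Column selections over arbitrary finite index types *)

(** The squared Frobenius error, grouped by columns because each column is approximated
    independently. *)
Definition selection_error {R : realType} {I J K : finType} (M : I -> J -> R)
    (g : K -> J) (a : K -> J -> R) : R :=
  \sum_j \sum_i (M i j - \sum_k M i (g k) * a k j) ^+ 2.

Lemma sum_enum_val {R : realType} {I : finType} (F : I -> R) :
  \sum_(i < #|I|) F (enum_val i) = \sum_i F i.
Proof. by rewrite [RHS](reindex (@enum_val I predT)) //; exact/onW_bij/enum_val_bij. Qed.

(** The infimum is attained, so bounding it amounts to finding one selection that meets the bound.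
    Enumerations transport selections between ordinals and finite types. *)
Lemma css_delta_le {R : realType} {I J K : finType} (M : I -> J -> R) (T : R) :
  (#|K| <= #|J|)%N -> 0 <= T ->
  css_delta #|K| (\matrix_(i < #|I|, j < #|J|) M (enum_val i) (enum_val j))
    <= Num.sqrt T <->
  exists (g : K -> J) (a : K -> J -> R),
    injective g /\ selection_error M g a <= T.
Proof.
move=> KJ T0; set X := (\matrix_(i, j) _).
have errE (f : 'I_#|K| -> 'I_#|J|) (A : 'M[R]_(#|K|, #|J|))
    (g : K -> J) (a : K -> J -> R) :
    (forall k, enum_val (f k) = g (enum_val k)) ->
    (forall k j, A k j = a (enum_val k) (enum_val j)) ->
    frobenius (X - colsub f X *m A) = Num.sqrt (selection_error M g a).
  move=> fg Aa; rewrite /frobenius /selection_error; congr Num.sqrt.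
  rewrite exchange_big /= -[RHS]sum_enum_val; apply: eq_bigr => j _.
  rewrite -[RHS]sum_enum_val; apply: eq_bigr => i _.
  rewrite !mxE -[in RHS]sum_enum_val; congr ((_ - _) ^+ 2).
  by apply: eq_bigr => k _; rewrite !mxE fg Aa.
have err0 (g : K -> J) a : 0 <= selection_error M g a.
  by do 2!apply: sumr_ge0 => ? _; apply: sqr_ge0.
have [Xmin Xle] := css_delta_min X KJ; split.
  case: Xmin => f [A [finj ->]] fA.
  pose g k := enum_val (f (enum_rank k)).
  pose a k j := A (enum_rank k) (enum_rank j).
  exists g, a; split.
    by move=> k k' /enum_val_inj /finj /enum_rank_inj.
  rewrite -ler_sqrt // -(errE f A) // => [k|k j]; first by rewrite /g enum_valK.
  by rewrite /a !enum_valK.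
case=> g [a [ginj le_ga]].
pose f (k : 'I_#|K|) : 'I_#|J| := enum_rank (g (enum_val k)).
pose A : 'M[R]_(#|K|, #|J|) := \matrix_(k, j) a (enum_val k) (enum_val j).
have fA : css_errors #|K| X (frobenius (X - colsub f X *m A)).
  exists f, A; split=> // k k' /enum_rank_inj /ginj; exact: enum_val_inj.
apply: le_trans (Xle _ fA) _.
rewrite (errE f A g a) ?ler_sqrt // => [k|k j]; first by rewrite enum_rankK.
by rewrite mxE.
Qed.

(** * Matrices close to the identity *)

(** At an index [v] where [|y v|] is maximal, [y = y Q + y (1 - Q)], and the last term is at most
    [n * |y v| / (2 n) = |y v| / 2]. *)
Lemma near_identity_bound {R : realType} {V : finType} (Q : V -> V -> R)
    (y : V -> R) (r : R) :
  (forall u v, `|(u == v)%:R - Q u v| * (2 * #|V|%:R) <= 1) ->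
  (forall v, `|\sum_u y u * Q u v| <= r) -> forall u, `|y u| <= 2 * r.
Proof.
move=> Q1 yQ u.
have V0 : 0 < #|V|%:R :> R by rewrite ltr0n; apply/card_gt0P; exists u.
have [v _ vmax] := @arg_maxP _ _ _ u predT (fun w => `|y w|) isT.
apply: le_trans (vmax u isT) _.
have yv : y v = \sum_w y w * Q w v + \sum_w y w * ((w == v)%:R - Q w v).
  rewrite -big_split /= (bigD1 v) //= eqxx big1 /=; first by ring.
  by move=> w /negPf -> /=; ring.
have : `|\sum_w y w * ((w == v)%:R - Q w v)| <= `|y v| / 2.
  apply: le_trans (ler_norm_sum _ _ _) _.
  have -> : `|y v| / 2 = \sum_(w : V) `|y v| / (2 * #|V|%:R).
    by rewrite sumr_const -mulr_natr; field; rewrite gt_eqF.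
  apply: ler_sum => w _; rewrite normrM; apply: ler_pM => //.
    exact: vmax.
  by rewrite -[leRHS]mul1r ler_pdivlMr // mulr_gt0.
have := yQ v; have := ler_normD (\sum_w y w * Q w v)
  (\sum_w y w * ((w == v)%:R - Q w v)).
rewrite -yv; lra.
Qed.

(** A vector [y] with [y S = 0] has [y S P = 0], so the previous bound with [r = 0] gives [y = 0].
    Hence the square matrix [S] is invertible. *)
Lemma near_inverse_solvable {R : realType} {V : finType} (S P : V -> V -> R)
    (s : V -> R) :
  (forall u v, `|(u == v)%:R - \sum_k S u k * P k v| * (2 * #|V|%:R) <= 1) ->
  exists y, forall k, \sum_u y u * S u k = s k.
Proof.
move=> SP.
pose X := \matrix_(i < #|V|, j < #|V|) S (enum_val i) (enum_val j).
have Xfree : row_free X.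
  rewrite -kermx_eq0; apply/eqP/row_matrixP => i; rewrite row0.
  set z := row i _; pose y u := z 0 (enum_rank u).
  have zX : z *m X = 0 by apply/eqP; rewrite -sub_kermx row_sub.
  have yS k : \sum_u y u * S u k = 0.
    transitivity ((z *m X) 0 (enum_rank k)); last by rewrite zX mxE.
    rewrite [RHS]mxE -[LHS]sum_enum_val.
    by apply: eq_bigr => j _; rewrite [X _ _]mxE /y enum_valK enum_rankK.
  have y0 : forall u, `|y u| <= 2 * 0.
    apply: (near_identity_bound _ _ _ SP) => v.
    under eq_bigr do rewrite mulr_sumr.
    rewrite exchange_big /= big1 ?normr0 // => k _.
    under eq_bigr do rewrite mulrA.
    by rewrite -mulr_suml yS mul0r.
  apply/rowP => j; rewrite [RHS]mxE; apply/eqP.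
  by have := y0 (enum_val j); rewrite /y enum_valK mulr0 normr_le0.
pose b := \row_(k < #|V|) s (enum_val k).
have /submxP [D bD] : (b <= X)%MS by exact: submx_full.
exists (fun u => D 0 (enum_rank u)) => k.
have /matrixP /(_ 0 (enum_rank k)) := bD.
rewrite !mxE enum_rankK => ->; rewrite -[LHS]sum_enum_val.
by apply: eq_bigr => j _; rewrite !mxE enum_valK enum_rankK.
Qed.

Lemma selection_entry_le {R : realType} {I J K : finType} (M : I -> J -> R)
    (g : K -> J) (a : K -> J -> R) i j :
  (M i j - \sum_k M i (g k) * a k j) ^+ 2 <= selection_error M g a.
Proof.
rewrite /selection_error (bigD1 j) //= (bigD1 i) //= -addrA lerDl addr_ge0 //.
  by apply: sumr_ge0 => ? _; apply: sqr_ge0.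
by do 2!apply: sumr_ge0 => ? _; apply: sqr_ge0.
Qed.

(** * Structure of selections of small error *)

Section GraphMatrix.
Variables (R : realType) (V : finType) (E : {set {set V}}).
Hypothesis simpleE : simple_graph E.

Local Notation t := (graph_t R E).
Local Notation n := (#|V|%:R : R).
Local Notation m := (#|E|%:R : R).
Local Notation M := (@graph_entry R V E).
Local Notation vertex u := (inl (inl u) : row_index V).
Local Notation color i := (inl (inr i) : row_index V).
Local Notation eps := (inr tt : row_index V).

Lemma selection_is_coloring (g : V -> col_index E) a :
  0 < n -> 0 < t -> 2 * t < 1 ->
  4 * n ^+ 2 * selection_error M g a <= 1 ->
  exists (phi : V -> 'I_3) (h : V -> V),
    bijective h /\ forall v, g (h v) = inl (v, phi v).
Proof.
move=> n0 t0 t1 err1.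
have n1 : 1 <= n by rewrite ler1n -(ltr0n R).
pose res x y := M x y - \sum_k M x (g k) * a k y.
(* A single residual is at most the square root of the total error, hence at most [1 / (2 n)]. *)
have res1 x y : `|res x y| * (2 * n) <= 1.
  rewrite -(@ler_pXn2r _ 2) ?nnegrE ?mulr_ge0 ?(ltW n0) // expr1n exprMn.
  rewrite real_normK ?num_real //.
  have := selection_entry_le M g a x y; rewrite -/(res x y) => le_err.
  by have := ler_wpM2l (sqr_ge0 n) le_err; nra.
(* Rows [V] and columns [v^1] of [M] form an identity block, so these residuals compare [S P] with
   the identity. *)
pose S u k := M (vertex u) (g k); pose P k v := a k (inl (v, ord0)).
have SP u v : `|(u == v)%:R - \sum_k S u k * P k v| * (2 * n) <= 1.
  by have := res1 (vertex u) (inl (v, ord0)); rewrite /res /=; case: (u == v).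
have [y yS] := near_inverse_solvable S P (fun k => M eps (g k)) SP.
(* Row [eps] of [M] vanishes on vertex columns, so [y S P] is, up to sign, a residual of that row,
   at most [1 / (2 n) <= 1 / 2]. *)
have y1 u : `|y u| <= 1.
  have -> : 1 = 2 * 2^-1 :> R by field.
  apply: (near_identity_bound _ _ _ SP) => v.
  under eq_bigr do rewrite mulr_sumr.
  rewrite exchange_big /=.
  under eq_bigr do (under eq_bigr do rewrite mulrA); under eq_bigr do
    rewrite -mulr_suml yS.
  have := res1 eps (inl (v, ord0)); rewrite /res /= sub0r normrN.
  set s := `|_|; have s0 : 0 <= s by apply: normr_ge0.
  nra.
(* Coordinate [k] of the system would read [t^2 * (y_u + y_w) = t], giving [t <= 2 t^2] against
   [2 t < 1]. *)
have noedge k e : g k <> inr e.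
  move=> gk; have := yS k; rewrite /S gk /=.
  have -> : \sum_u y u * (if u \in val e then t ^+ 2 else 0)
          = (\sum_(u in val e) y u) * t ^+ 2.
    rewrite mulr_suml [RHS]big_mkcond; apply: eq_bigr => u _.
    by case: ifP => // _; rewrite mulr0.
  have : `|\sum_(u in val e) y u| <= 2.
    apply: le_trans (ler_norm_sum _ _ _) _.
    apply: le_trans (ler_sum _ (fun u _ => y1 u)) _.
    by rewrite sumr_const (simpleE _ (valP e)).
  by rewrite ler_norml => /andP [_ y2]; nra.
(* Without a selected copy of [v], row [v] of [S] is zero and the diagonal residual is 1, which is
   too large. *)
have cover v : exists p : V * 'I_3, g p.1 = inl (v, p.2).
  case: (boolP [exists p : V * 'I_3, g p.1 == inl (v, p.2)]).
    by case/existsP => p /eqP; exists p.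
  rewrite negb_exists => /forallP gv.
  have := SP v v; rewrite big1 => [|k _].
    by rewrite eqxx subr0 normr1; lra.
  rewrite /S; case gk: (g k) => [[w i]|e]; last by case: (noedge k e).
  rewrite /=; case: eqP => [vw|_]; last by rewrite mul0r.
  by have := gv (k, i); rewrite gk vw eqxx.
have [p gp] := fin_all_exists cover.
exists (fun v => (p v).2), (fun v => (p v).1); split=> //.
(* The column [g (h v)] determines [v], so [h] is injective, hence bijective by finiteness. *)
apply: injF_bij => u v puv; have := gp u; rewrite puv gp.
by case.
Qed.

(** * Error of the selection given by a color assignment *)

(* The residual in row [i] of the approximation of column [y] by the columns
   [v^(phi v)] that is exact on the rows in [V]. *)
Definition color_defect (phi : V -> 'I_3) (y : col_index E) (i : 'I_3) : R :=
  M (color i) y - t ^+ 3 * \sum_(v | phi v == i) M (vertex v) y.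

(** The selected columns form the identity on the rows [V], carry [t^3] in the row of their color,
    and vanish in row [eps]. *)
Lemma column_errorE (phi : V -> 'I_3) (a : V -> R) (y : col_index E) :
  \sum_x (M x y - \sum_v M x (inl (v, phi v)) * a v) ^+ 2
  = \sum_u (M (vertex u) y - a u) ^+ 2
  + \sum_i (M (color i) y - t ^+ 3 * \sum_(v | phi v == i) a v) ^+ 2
  + M eps y ^+ 2.
Proof.
rewrite !big_sumType /=; congr (_ + _ + _).
- apply: eq_bigr => u _; rewrite (bigD1 u) //= eqxx mul1r big1 ?addr0 // => v.
  by rewrite eq_sym => /negPf ->; rewrite mul0r.
- apply: eq_bigr => i _; congr ((_ - _) ^+ 2).
  rewrite mulr_sumr [RHS]big_mkcond; apply: eq_bigr => v _.
  by rewrite eq_sym; case: ifP => // _; rewrite mul0r.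
- rewrite (bigD1 tt) //= [X in _ + X]big1 ?addr0; last by case.
  by rewrite big1 ?subr0 // => v _; rewrite mul0r.
Qed.

(* Moving [a] away from the exact approximation by [b] costs [b_v^2] and gains at
   most [2 t^3 D_(phi v) b_v], hence at most [t^6 D_(phi v)^2] per vertex. *)
Lemma column_error_ge (phi : V -> 'I_3) (a : V -> R) (y : col_index E) :
  (1 - n * t ^+ 6) * \sum_i color_defect phi y i ^+ 2 + M eps y ^+ 2
  <= \sum_x (M x y - \sum_v M x (inl (v, phi v)) * a v) ^+ 2.
Proof.
rewrite column_errorE lerD2r.
set D := color_defect phi y; set W := \sum_i D i ^+ 2.
pose b v := a v - M (vertex v) y.
have Db i : M (color i) y - t ^+ 3 * \sum_(v | phi v == i) a v
          = D i - t ^+ 3 * \sum_(v | phi v == i) b v.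
  by rewrite /D /color_defect sumrB; ring.
(* Expanding each square, the term [(t^3 B)^2] is dropped and the cross terms are regrouped by
   vertex. *)
have colors_ge : W - \sum_v 2 * t ^+ 3 * D (phi v) * b v
    <= \sum_i (M (color i) y - t ^+ 3 * \sum_(v | phi v == i) a v) ^+ 2.
  rewrite (partition_big phi predT) //= -sumrB.
  apply: ler_sum => i _; rewrite Db.
  have -> : \sum_(v | phi v == i) 2 * t ^+ 3 * D (phi v) * b v
          = 2 * t ^+ 3 * D i * \sum_(v | phi v == i) b v.
    by rewrite mulr_sumr; apply: eq_bigr => v /eqP ->.
  set B := \sum_(v | _) _; have := sqr_ge0 (t ^+ 3 * B); nra.
have sq_ge v : - (t ^+ 6 * W)
    <= (M (vertex v) y - a v) ^+ 2 - 2 * t ^+ 3 * D (phi v) * b v.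
  have DW : D (phi v) ^+ 2 <= W.
    by rewrite /W (bigD1 (phi v)) //= lerDl sumr_ge0 // => i _; apply: sqr_ge0.
  have -> : (M (vertex v) y - a v) ^+ 2 = b v ^+ 2 by rewrite /b; ring.
  have /= := ler_wpM2l (exprn_even_ge0 t (isT : ~~ odd 6)) DW.
  have := sqr_ge0 (b v - t ^+ 3 * D (phi v)).
  set x := D _; have -> : (b v - t ^+ 3 * x) ^+ 2
    = b v ^+ 2 - 2 * t ^+ 3 * x * b v + t ^+ 6 * x ^+ 2 by ring.
  lra.
have : \sum_(v : V) - (t ^+ 6 * W)
    <= \sum_v ((M (vertex v) y - a v) ^+ 2 - 2 * t ^+ 3 * D (phi v) * b v).
  by apply: ler_sum => v _; apply: sq_ge.
have -> : \sum_(v : V) - (t ^+ 6 * W) = - (n * t ^+ 6 * W).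
  by rewrite sumr_const -[- _ *+ _]mulr_natr; ring.
rewrite sumrB; lra.
Qed.

(** Replacing [v^j] by [v^(phi v)] moves the entry [t^3] to another color row, leaving two wrong
    entries unless the colors agree. *)
Lemma vertex_defect (phi : V -> 'I_3) (v : V) (j : 'I_3) :
  \sum_i color_defect phi (inl (v, j)) i ^+ 2
  = if phi v == j then 0 else 2 * t ^+ 6.
Proof.
have D i : color_defect phi (inl (v, j)) i
         = t ^+ 3 * ((i == j)%:R - (phi v == i)%:R).
  rewrite /color_defect /= mulrBr; congr (_ - t ^+ 3 * _).
    by case: eqP; rewrite ?mulr1 ?mulr0.
  rewrite big_mkcond (bigD1 v) //= eqxx big1 => [|u /negPf ->].
    by rewrite addr0; case: eqP.
  by case: ifP.
under eq_bigr do rewrite D.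
rewrite !big_ord_recl big_ord0.
by case: j {D} => [[|[|[|j]]] ?] //; case: (phi v) => [[|[|[|k]]] ?] //=; ring.
Qed.

(** The approximation puts [t^5] in the color rows of [u] and [w]. Distinct colors cancel two of the
    three entries [t^5]; equal colors turn one into [-t^5] and cancel none. *)
Lemma edge_defect (phi : V -> 'I_3) (e : {e | e \in E}) (u w : V) :
  u != w -> val e = [set u; w] ->
  \sum_i color_defect phi (inr e) i ^+ 2
  = t ^+ 10 * (1 + 2 * (phi u == phi w)%:R).
Proof.
move=> uw euw.
have D i : color_defect phi (inr e) i
         = t ^+ 5 * (1 - (phi u == i)%:R - (phi w == i)%:R).
  rewrite /color_defect /= big_mkcond (bigD1 u) //= (bigD1 w) 1?eq_sym //=.
  rewrite big1 => [|v /andP [/negPf vu /negPf vw]].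
    by rewrite euw !inE !eqxx orbT /=; do 2!case: eqP => _ /=; ring.
  by rewrite euw !inE vu vw /= if_same.
under eq_bigr do rewrite D.
rewrite !big_ord_recl big_ord0.
by case: (phi u) => [[|[|[|j]]] ?] //; case: (phi w) => [[|[|[|k]]] ?] //=; ring.
Qed.

Lemma sum_columns (F : col_index E -> R) :
  \sum_y F y = \sum_v \sum_j F (inl (v, j)) + \sum_e F (inr e).
Proof.
rewrite big_sumType pair_big /=; congr (_ + _).
by apply: eq_bigr => -[].
Qed.

Lemma sum_edges_const (c : R) : \sum_(e : {e | e \in E}) c = m * c.
Proof. by rewrite sumr_const card_sig mulr_natl. Qed.

(** Each vertex has two copies of the wrong color, each costing [2 t^6]. *)
Lemma sum_vertices_defect (phi : V -> 'I_3) :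
  \sum_v \sum_j \sum_i color_defect phi (inl (v, j)) i ^+ 2 = 4 * n * t ^+ 6.
Proof.
rewrite (eq_bigr (fun=> 4 * t ^+ 6)) => [|v _].
  by rewrite sumr_const -[_ * _ *+ _]mulr_natr; ring.
under eq_bigr do rewrite vertex_defect.
by rewrite !big_ord_recl big_ord0; case: (phi v) => [[|[|[|k]]] ?] //=; ring.
Qed.

Lemma edge_endpoints (e : {e | e \in E}) :
  exists u w, u != w /\ val e = [set u; w].
Proof.
have /eqP/cards2P [u [w [uw ->]]] := simpleE _ (valP e).
by exists u, w.
Qed.

Lemma coloring_error (phi : V -> 'I_3) :
  three_coloring E phi ->
  selection_error M (fun v => inl (v, phi v)) (fun v y => M (vertex v) y)
  = m * t ^+ 2 + 4 * n * t ^+ 6 + m * t ^+ 10.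
Proof.
move=> col; rewrite /selection_error.
under eq_bigr do rewrite column_errorE.
rewrite (eq_bigr (fun y => \sum_i color_defect phi y i ^+ 2 + M eps y ^+ 2)).
  rewrite big_split /= !sum_columns sum_vertices_defect.
  rewrite (eq_bigr (fun=> t ^+ 10)) => [|e _].
    rewrite [X in _ + (X + _)]big1 => [|v _]; last first.
      by rewrite big1 // => i _; rewrite /= expr0n.
    by rewrite !sum_edges_const; ring.
  have [u [w [uw euw]]] := edge_endpoints e.
  rewrite (edge_defect _ _ _ _ uw euw).
  have /eqP/negPf -> : phi u <> phi w by apply: col; rewrite -euw; apply: valP.
  by rewrite /= mulr0 addr0 mulr1.
move=> y _; rewrite big1 ?add0r // => v _.
by rewrite subrr expr0n.
Qed.

(** One monochromatic edge suffices: its defect is [3 t^10] instead of [t^10], whence [m + 2]. *)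
Lemma selection_error_ge (phi : V -> 'I_3) (a : V -> col_index E -> R) :
  ~ three_coloring E phi -> n * t ^+ 6 <= 1 ->
  (1 - n * t ^+ 6) * (4 * n * t ^+ 6 + (m + 2) * t ^+ 10) + m * t ^+ 2
  <= selection_error M (fun v => inl (v, phi v)) a.
Proof.
move=> ncol nt1.
have : \sum_y ((1 - n * t ^+ 6) * (\sum_i color_defect phi y i ^+ 2)
               + M eps y ^+ 2)
    <= selection_error M (fun v => inl (v, phi v)) a.
  by apply: ler_sum => y _; apply: column_error_ge.
apply: le_trans.
rewrite big_split /= -mulr_sumr !sum_columns sum_vertices_defect.
rewrite [X in _ <= _ + (X + _)]big1 => [|v _]; last first.
  by rewrite big1 // => i _; rewrite /= expr0n.
rewrite /= sum_edges_const add0r lerD2r ler_wpM2l ?subr_ge0 // lerD2l.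
have edge_ge e : t ^+ 10 <= \sum_i color_defect phi (inr e) i ^+ 2.
  have [u [w [uw euw]]] := edge_endpoints e.
  rewrite (edge_defect _ _ _ _ uw euw).
  by rewrite ler_peMr ?exprn_even_ge0 // lerDl mulr_ge0 ?ler0n.
have [e0 e0_ge] : exists e0 : {e | e \in E},
    3 * t ^+ 10 <= \sum_i color_defect phi (inr e0) i ^+ 2.
  apply: contra_notP ncol => noe u w uwE phi_uw; apply: noe.
  pose e0 : {e | e \in E} := exist (fun e => is_true (e \in E)) _ uwE.
  exists e0.
  have uw : u != w.
    by have := simpleE _ uwE; case: eqP => // ->; rewrite setUid cards1.
  rewrite (edge_defect _ e0 _ _ uw erefl) phi_uw eqxx /=; lra.
have -> : (m + 2) * t ^+ 10 = \sum_(e : {e | e \in E}) t ^+ 10 + 2 * t ^+ 10.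
  by rewrite sum_edges_const mulrDl.
rewrite (bigD1 e0) //= [leRHS](bigD1 e0) //=.
rewrite addrAC; apply: lerD; last by apply: ler_sum => e _.
by apply: le_trans e0_ge; lra.
Qed.

End GraphMatrix.

(** * Numerical estimates *)

Lemma graph_t_bounds {R : realType} {V : finType} (E : {set {set V}}) :
  (0 < #|V|)%N -> (0 < #|E|)%N ->
  let t := graph_t R E in
  [/\ 0 < t, t <= 1 / 32, #|V|%:R * t <= 1 / 16
    & #|V|%:R * #|E|%:R * t <= 1 / 8].
Proof.
rewrite -!(ler1n R) /graph_t natrD.
set n := #|V|%:R; set m := #|E|%:R => n1 m1 /=.
have q0 : 0 < 4 * (m + n) ^+ 3 by rewrite mulr_gt0 // exprn_gt0 // ltr_wpDl //; lra.
have q2 : 2 <= m + n by lra.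
have q4 : 4 <= (m + n) ^+ 2 by nra.
split; first by rewrite invr_gt0.
- by rewrite -[leLHS]mul1r ler_pdivrMr //; nra.
- by rewrite ler_pdivrMr //; nra.
- rewrite ler_pdivrMr //.
  have : 4 * (n * m) <= (m + n) ^+ 2 by have := sqr_ge0 (m - n); nra.
  nra.
Qed.

(** For the strict inequality, the gain [2 t^10] from a monochromatic edge outweighs the loss
    [x t^6 (4 x t^6 + (y + 2) t^10)] from the factor [1 - x t^6]. *)
Lemma threshold_bounds {R : realType} (x y t : R) :
  0 < x -> 0 < y -> 0 < t -> t <= 1 / 32 -> x * t <= 1 / 16 ->
  x * y * t <= 1 / 8 ->
  let T := y * t ^+ 2 + 4 * x * t ^+ 6 + y * t ^+ 10 in
  [/\ 4 * x ^+ 2 * T <= 1, x * t ^+ 6 <= 1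
    & T < (1 - x * t ^+ 6) * (4 * x * t ^+ 6 + (y + 2) * t ^+ 10) + y * t ^+ 2].
Proof.
move=> x0 y0 t0 t1 xt xyt T.
have p0 : 0 < x * t by rewrite mulr_gt0.
have q0 : 0 < x * y * t by rewrite !mulr_gt0.
have tX k : 0 <= t ^+ k <= 1.
  by rewrite exprn_ge0 ?exprn_ile1 ?(ltW t0) //; lra.
have pq : (x * y * t) * (x * t) <= 1 / 128 by nra.
have pp : (x * t) ^+ 2 <= 1 / 256 by nra.
split.
- have -> : 4 * x ^+ 2 * T = 4 * ((x * y * t) * (x * t)) * (1 + t ^+ 8)
    + 16 * ((x * t) ^+ 2 * ((x * t) * t ^+ 3)) by rewrite /T; ring.
  have p3 : 0 <= (x * t) * t ^+ 3 <= 1 by have := tX 3%N; nra.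
  have pq0 : 0 <= (x * y * t) * (x * t) by rewrite mulr_ge0 ?ltW.
  have := sqr_ge0 (x * t); have := tX 8%N; nra.
- have -> : x * t ^+ 6 = (x * t) * t ^+ 5 by ring.
  by have := tX 5%N; nra.
- rewrite -subr_gt0.
  have -> : (1 - x * t ^+ 6) * (4 * x * t ^+ 6 + (y + 2) * t ^+ 10)
      + y * t ^+ 2 - T
    = t ^+ 10 * (2 - 4 * (x * t) ^+ 2 - (x * y * t + 2 * (x * t)) * t ^+ 5).
    by rewrite /T; ring.
  by rewrite mulr_gt0 ?exprn_gt0 //; have := tX 5%N; nra.
Qed.

Theorem theorem3p1 (R : realType) (V : finType) (E : {set {set V}}) (n m : nat)
    (hG : simple_graph E) (hn : n = #|V|) (hm : m = #|E|)
    (n_ge1 : (1 <= n)%N) (m_ge1 : (1 <= m)%N) :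
  let t := graph_t R E in
  (exists phi : V -> 'I_3, three_coloring E phi) <->
  css_delta n (graph_mx R E) <=
    Num.sqrt (m%:R * t ^+ 2 + 4 * n%:R * t ^+ 6 + m%:R * t ^+ 10).
Proof.
subst n m => t; set T := _ + _ + _.
have [t0 t1 nt nmt] := @graph_t_bounds R V E n_ge1 m_ge1.
rewrite -/t in t0 t1 nt nmt.
have n1 : 1 <= #|V|%:R :> R by rewrite ler1n.
have m1 : 1 <= #|E|%:R :> R by rewrite ler1n.
have n0 : 0 < #|V|%:R :> R by lra.
have m0 : 0 < #|E|%:R :> R by lra.
have [T1 nt6 T_lt] := threshold_bounds _ _ _ n0 m0 t0 t1 nt nmt.
have T0 : 0 <= T.
  have tX k : 0 <= t ^+ k by rewrite exprn_ge0 // ltW.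
  have := mulr_ge0 (ltW m0) (tX 2%N); have := mulr_ge0 (ltW n0) (tX 6%N).
  by have := mulr_ge0 (ltW m0) (tX 10%N); rewrite /T; lra.
have VC : (#|V| <= #|col_index E|)%N.
  by rewrite card_sum card_prod card_ord (leq_trans (leq_pmulr _ _) (leq_addr _ _)).
refine (iff_trans _ (iff_sym (css_delta_le (@graph_entry R V E) T VC T0))); split.
  move=> [phi col]; exists (fun v => inl (v, phi v)), (fun v y => graph_entry R (inl (inl v)) y).
  split; first by move=> u v [].
  by rewrite coloring_error.
move=> [g [a [_ err_le]]].
have err1 : 4 * #|V|%:R ^+ 2 * selection_error (@graph_entry R V E) g a <= 1.
  by apply: le_trans T1; rewrite ler_wpM2l // mulr_ge0 ?sqr_ge0.
have [|phi [h [hbij gh]]] := selection_is_coloring R V E hG g a n0 t0 _ err1.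
  by rewrite -/t; lra.
exists phi; apply: contrapT => ncol.
have := selection_error_ge R V E hG phi (fun v => a (h v)) ncol nt6.
(* Renaming the selected columns along [h] only permutes the terms of each combination. *)
have -> : selection_error (@graph_entry R V E) (fun v => inl (v, phi v))
    (fun v => a (h v)) = selection_error (@graph_entry R V E) g a.
  apply: eq_bigr => y _; apply: eq_bigr => x _; congr ((_ - _) ^+ 2).
  rewrite [RHS](reindex h) /=; last exact: onW_bij.
  by apply: eq_bigr => v _; rewrite gh.
by move/(lt_le_trans T_lt); rewrite ltNge err_le.
Qed.
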